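(* Let $T$ be a tree and let $f:T\to T$ be a tree map (i.e. a continuous function from $T$ into itself) such that no cut-point of $T$ is fixed under $f$. Then there is a unique attracting fixed point of $f$ in $T$ (which is, of course, an endpoint of $T$).
   Context: An interval is any space homeomorphic to $[0,1]\subset\mathbb{R}$. A tree is a uniquely arcwise connected space that is either a point or a union of finitely many intervals; any tree is a continuum, i.e. a nonempty compact connected metric space. The valence of $x\in T$ is the number of connected components of $T\setminus\{x\}$. Points of valence one are the endpoints of $T$; points of valence greater than one are the cut-points of $T$. Given a continuous map $f:X\to X$, a point $x\in X$ is called an attracting fixed point of $f$ if for any open set $U\ni x$ there is an open set $V$ with $x\in V\subseteq U$ such that $f(\overline{V})\subseteq V$, where $\overline{V}$ denotes the closure of $V$.
   Formalization: The remark that the attracting fixed point is an endpoint is stated only when the tree is not a single point: a one-point tree's only point has valence zero, so it is not an endpoint by the definition; existence and uniqueness are stated for all trees. *)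

(* Defs.v *)
From HB Require Import structures.
From mathcomp Require Import all_boot all_order all_algebra.
From mathcomp Require Import all_classical all_reals all_analysis.
Import Order.TTheory GRing.Theory Num.Theory.
Import numFieldNormedType.Exports.

Set Implicit Arguments.
Unset Strict Implicit.
Unset Printing Implicit Defensive.

Local Open Scope classical_set_scope.
Local Open Scope card_scope.
Local Open Scope ring_scope.

(* f and g are mutually inverse homeomorphisms between the subspaces A of X
   and B of Y; their values outside A and B are irrelevant. *)
Definition homeomorphism_on (X Y : topologicalType) (A : set X) (B : set Y)
    (f : X -> Y) (g : Y -> X) : Prop :=
  [/\ set_fun A B f /\ set_fun B A g,
      {in A, cancel f g} /\ {in B, cancel g f},
      {within A, continuous f} &
      {within B, continuous g}].

Definition interval_space (R : realType) (T : topologicalType) (A : set T)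
    : Prop :=
  exists (f : R -> T) (g : T -> R), homeomorphism_on `[0 : R, 1] A f g.

Definition arc_between (R : realType) (T : topologicalType) (x y : T)
    (A : set T) : Prop :=
  exists (f : R -> T) (g : T -> R),
    [/\ homeomorphism_on `[0 : R, 1] A f g, f 0 = x & f 1 = y].

(* An arc is a subset of T, not a parametrization. *)
Definition uniquely_arcwise_connected (R : realType) (T : topologicalType)
    : Prop :=
  forall x y : T, x <> y -> exists! A : set T, arc_between R x y A.

Definition one_point (T : Type) : Prop := exists x : T, [set: T] = [set x].

(* The family F must be nonempty: otherwise the empty space would be a tree. *)
Definition tree (R : realType) (T : metricType R) : Prop :=
  uniquely_arcwise_connected R T /\
  (one_point T \/
   exists F : set (set T),
     [/\ finite_set F, F !=set0, F `<=` interval_space R (T:=T) &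
         \bigcup_(A in F) A = [set: T]]).

(* The valence of x is the cardinality of this set. *)
Definition branches (T : topologicalType) (x : T) : set (set T) :=
  connected_component (~` [set x]) @` (~` [set x]).

Definition endpoint (T : topologicalType) (x : T) : Prop :=
  branches x #= `I_1.

Definition cut_point (T : topologicalType) (x : T) : Prop :=
  `I_2 #<= branches x.

(* That f x = x need not be assumed: see attracting_fixed_point_fixed. *)
Definition attracting_fixed_point (T : topologicalType) (f : T -> T) (x : T)
    : Prop :=
  forall U : set T, open U -> U x ->
    exists V : set T, [/\ open V, V x, V `<=` U & f @` closure V `<=` V].

Lemma attracting_fixed_point_fixed (R : realType) (T : metricType R)
    (f : T -> T) (x : T) : attracting_fixed_point f x -> f x = x.
Proof.
move=> fx; apply/esym/(@metric_hausdorff _ T) => A B Ax Bfx.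
have [V [oV Vx VA fV]] := fx _ (@open_interior _ A) Ax.
exists (f x); split; last exact: nbhs_singleton Bfx.
by apply: (@interior_subset _ A); apply/VA/fV; exists x => //;
  exact: subset_closure.
Qed.

(* Main.v *)
Require Import Defs.
From HB Require Import structures.
From mathcomp Require Import all_boot all_order all_algebra.
From mathcomp Require Import all_classical all_reals all_analysis.
From mathcomp Require Import lra.
Import Order.TTheory GRing.Theory Num.Theory.
Import numFieldNormedType.Exports.

Set Implicit Arguments.
Unset Strict Implicit.
Unset Printing Implicit Defensive.

Local Open Scope classical_set_scope.
Local Open Scope card_scope.
Local Open Scope ring_scope.

(** Fix a root [x].  In a tree the relation [y <= z] meaning that [y] lies on
    the arc from [x] to [z] is a partial order whose lower sets are arcs.
    Since [T] is covered by the arcs from [x] to finitely many points, the set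
    of points above a given [q] is closed ([above_closed]) and the set of
    points strictly above it is open ([strictly_above_open]).  Hence a point
    other than the root with something above it is a cut-point
    ([cut_point_between]), while a point that is neither the root nor a
    cut-point is maximal and has a base of neighbourhoods made of the sets of
    points strictly above some [q] ([noncut_nbhd]).

    Existence.  Let [x] be interior to an arc; then it is a cut-point, so
    [f x <> x].  Say that [y] moves up if [y < f y], and consider the points
    [z] such that every [y < z] moves up.  On each arc from the root they form
    a closed initial piece, so finiteness of the tree yields a maximal such
    point [m] ([moves_up_below_max]).  By continuity [m <= f m], and
    [m < f m] would allow going beyond [m]; so [f m = m], and [m] is not a
    cut-point.  Every [y < m] moves up, so [f] sends the closure of
    [{z | q < z}] into [{z | q < z}] for each [q < m] close to [m], and [m] is
    attracting.

    Uniqueness.  Two distinct attracting fixed points [a] and [b] are not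
    cut-points.  Let [p] be interior to the arc from [a] to [b].  Between [p]
    and [b] some point of this arc is moved towards [b], and between [p] and
    [a] some point is moved towards [a] ([attracting_moves_up]).  With [a] as
    the root, let [c] be the first point after the latter one at which
    [c <= f c].  It is a cut-point, hence [c < f c]; since
    the points strictly above [c] form an open set, the points just before [c]
    also move up, contradicting the choice of [c].

    The attracting fixed point is not a cut-point, so its complement has at
    most one component, and exactly one when [T] is not a point. *)

(** * Parametrized arcs *)

Lemma within_continuous_precomp (X Y Z : topologicalType) (A : set X)
    (B : set Y) (u : X -> Y) (g : Y -> Z) :
  {homo u : x / A x >-> B x} -> continuous u -> {within B, continuous g} ->
  {within A, continuous (g \o u)}.
Proof.
move=> uAB cu /subspace_continuousP cg; apply/subspace_continuousP => x Ax.
move=> W /(cg _ (uAB _ Ax)) /= /cu; rewrite /within /= !near_simpl.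
by apply: filterS => y /= h /uAB; exact: h.
Qed.

Section arc_paths.
Context {R : realType} {T : metricType R}.
Implicit Types (g : R -> T) (a b c d s t : R) (x y z : T) (A : set T).

(** Unlike [arc_between], this asks for no inverse and allows any nondegenerate
    interval, which makes subarcs, reversed arcs and concatenations cheap. *)
Definition arc_path g a b : Prop :=
  [/\ a < b, {within `[a, b], continuous g} &
      forall s t, a <= s <= b -> a <= t <= b -> g s = g t -> s = t].

Lemma arc_path_sub g a b c d :
  arc_path g a b -> a <= c -> c < d -> d <= b -> arc_path g c d.
Proof.
move=> [ab cg ig] ac cd db; split=> //; last first.
  by move=> s t hs ht; apply: ig; lra.
apply: continuous_subspaceW cg; apply: subset_itv; rewrite bnd_simp //.
Qed.

Lemma arc_path_opp g a b : arc_path g a b -> arc_path (g \o -%R) (- b) (- a).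
Proof.
move=> [ab cg ig]; split; first by lra.
  apply: (within_continuous_precomp _ _ cg); last exact: oppr_continuous.
  by move=> t /=; rewrite !in_itv /=; lra.
by move=> s t hs ht /= /ig; lra.
Qed.

Lemma arc_path_unit g a b : arc_path g a b ->
  arc_path (fun t => g (a + t * (b - a))) 0 1.
Proof.
move=> [ab cg ig]; split => //.
  apply: (within_continuous_precomp (u := fun t => a + t * (b - a)) _ _ cg).
    by move=> t /=; rewrite !in_itv /= => ht; nra.
  move=> t; apply: cvgD; first exact: cvg_cst.
  by apply: cvgM; [exact: cvg_id | exact: cvg_cst].
move=> s t hs ht /ig h.
have : a + s * (b - a) = a + t * (b - a) by apply: h; nra.
by move/addrI/mulIf; apply; lra.
Qed.

(** The inverse of a continuous injection [g] of [[0, 1]] is continuous because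
    the preimages of closed sets under it are images under [g] of compact sets,
    and these are closed in a metric space. *)
Lemma arc_path_arc01 g : arc_path g 0 1 ->
  arc_between R (g 0) (g 1) (g @` `[0 , 1]).
Proof.
move=> [_ cg ig].
have inj : {in [set` `[0, 1]] &, injective g}.
  by move=> s t; rewrite !inE /= !in_itv /=; exact: ig.
pose h := 'pinv_(fun=> 0) [set` `[0, 1]] g.
have hK : {in [set` `[0, 1]], cancel g h} by exact: pinvKV.
exists g, h; split=> //; split; [split|split| exact: cg |].
- by move=> t ht; exists t.
- by move=> _ [t ht <-]; rewrite hK ?inE.
- exact: hK.
- by move=> x; rewrite inE => -[t ht <-]; rewrite hK ?inE.
- apply/continuous_closedP => C cC; apply/closed_subspaceP.
  exists (g @` (`[0, 1] `&` C)).
    apply: compact_closed; first exact: metric_hausdorff.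
    apply: continuous_compact.
      by apply: continuous_subspaceW cg => t [].
    by apply: compact_closedI => //; exact: segment_compact.
  apply/seteqP; split=> x.
    move=> [[t [ht Ct] <-] _]; split; last by exists t.
    by change (C (h (g t))); rewrite hK ?inE.
  move=> [/= Ch [t ht tx]]; split; last by exists t.
  exists t => //; split=> //.
  by move: Ch; change (C (h x) -> C t); rewrite -tx hK ?inE.
Qed.

Lemma arc_path_arc g a b : arc_path g a b ->
  arc_between R (g a) (g b) (g @` `[a, b]).
Proof.
move=> gab; have := arc_path_arc01 (arc_path_unit gab).
case: gab => ab _ _.
rewrite mul0r addr0 mul1r subrKC.
suff -> : g @` `[a, b] = (fun t => g (a + t * (b - a))) @` `[0, 1] by [].
apply/seteqP; split=> y [t] /=; rewrite in_itv /= => ht <-; last first.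
  by exists (a + t * (b - a)) => //; rewrite in_itv /=; nra.
exists ((t - a) / (b - a)); last by rewrite divfK ?subrKC//; lra.
by rewrite in_itv /= ler_pdivlMr ?ler_pdivrMr; lra.
Qed.

Lemma arc_between_path x z A : arc_between R x z A ->
  exists g, [/\ arc_path g 0 1, g 0 = x, g 1 = z & A = g @` `[0, 1]].
Proof.
move=> [g [h [[[fg fh] [hK gK] cg ch] g0 g1]]]; exists g; split=> //.
  split=> // s t hs ht st.
  by rewrite -(hK s) ?st ?hK ?inE //= ?in_itv.
apply/seteqP; split=> [y Ay|_ [t ht <-]]; last exact: fg.
by exists (h y); [exact: fh | rewrite gK ?inE].
Qed.

(** The concatenation runs along [g], then along [h] shifted by [b - c]; it is
    injective because the two images meet in the junction point only. *)
Lemma arc_path_cat g h a b c d : arc_path g a b -> arc_path h c d ->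
  g b = h c ->
  (forall s t, a <= s <= b -> c <= t <= d -> g s = h t -> t = c) ->
  exists k, [/\ arc_path k a (b + (d - c)), k a = g a, k (b + (d - c)) = h d &
    k @` `[a, b + (d - c)] = g @` `[a, b] `|` h @` `[c, d]].
Proof.
move=> [ab cg ig] [cd ch ih] gh disj.
pose k t := if t <= b then g t else h (t - b + c).
have kg t : t <= b -> k t = g t by rewrite /k => ->.
have kh t : b <= t -> k t = h (t - b + c).
  rewrite /k le_eqVlt => /orP[/eqP <-|]; first by rewrite lexx subrr add0r.
  by rewrite ltNge => /negbTE ->.
exists k; split; first split; first by lra.
- have -> : [set` `[a, b + (d - c)]] = `[a, b] `|` `[b, b + (d - c)].
    apply/seteqP; split=> t /=; rewrite !in_itv /=; last by lra.
    by case: (lerP t b) => tb h1; [left|right]; lra.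
  apply: withinU_continuous; try exact: itv_closed.
    apply: (@subspace_eq_continuous _ _ _ g) cg.
    by move=> t; rewrite inE /= in_itv /= => /andP[_ /kg].
  apply: (@subspace_eq_continuous _ _ _ (h \o (fun t => t - b + c))).
    by move=> t; rewrite inE /= in_itv /= => /andP[/kh].
  apply: (within_continuous_precomp _ _ ch).
    by move=> t /=; rewrite !in_itv /=; lra.
  move=> t; apply: cvgD; last exact: cvg_cst.
  by apply: cvgB; [exact: cvg_id|exact: cvg_cst].
- move=> s t hs ht.
  case: (lerP s b) => sb; case: (lerP t b) => tb.
  + by rewrite !kg//; apply: ig; lra.
  + by rewrite kg// kh ?ltW// => /disj; lra.
  + by rewrite kh ?ltW// kg// => /esym /disj; lra.
  + by rewrite !kh ?ltW// => /ih; lra.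
- by rewrite kg// ltW.
- by rewrite kh; [congr h; lra | lra].
- apply/seteqP; split=> y.
    move=> [t] /=; rewrite in_itv /= => ht <-.
    case: (lerP t b) => tb; [left; exists t|right; exists (t - b + c)].
    + by rewrite /= in_itv /=; lra.
    + by rewrite kg.
    + by rewrite /= in_itv /=; lra.
    + by rewrite kh// ltW.
  move=> [] [t] /=; rewrite in_itv /= => ht <-.
    by exists t; [rewrite /= in_itv /=; lra| rewrite kg//; lra].
  exists (t + b - c); first by rewrite /= in_itv /=; lra.
  by rewrite kh; [congr h; lra | lra].
Qed.

Lemma path_near g s (U : set T) : {within `[0, 1], continuous g} ->
  0 <= s <= 1 -> open U -> U (g s) ->
  exists2 e : R, 0 < e & forall t, 0 <= t <= 1 -> `|t - s| < e -> U (g t).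
Proof.
move=> /subspace_continuousP cg hs oU Us.
have s01 : [set` `[0, 1]] s by rewrite /= in_itv.
have := cg s s01 U (open_nbhs_nbhs (conj oU Us)).
rewrite /within /= => /nbhs_ballP [e e0 he]; exists e => // t ht ts.
by apply: he; rewrite /= ?in_itv// /ball /= distrC.
Qed.

(** A form of the infimum of a subset of [[0, 1]] that is convenient with
    [path_near]: a lower bound approached from the right. *)
Lemma inf_unit (P : R -> Prop) : (exists2 t, 0 <= t <= 1 & P t) ->
  exists c, [/\ 0 <= c <= 1, forall t, 0 <= t <= 1 -> P t -> c <= t &
    forall e, 0 < e -> exists t, [/\ 0 <= t <= 1, P t & t < c + e]].
Proof.
move=> [t0 ht0 Pt0]; pose D := [set t | 0 <= t <= 1 /\ P t].
have Dlb : lbound D 0 by move=> t [/andP[]].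
have hD : has_inf D by split; [exists t0|exists 0].
have lbD t : D t -> inf D <= t by move=> Dt; apply: inf_lbound => //; exists 0.
exists (inf D); split.
- rewrite (le_trans (lbD t0 _))//; last by case/andP: ht0.
  by rewrite andbT; apply: lb_le_inf => //; exists t0.
- by move=> t ht Pt; exact: lbD.
- by move=> e e0; have [t [ht Pt] te] := inf_adherent e0 hD; exists t.
Qed.

Lemma first_hit g A : {within `[0, 1], continuous g} -> closed A -> A (g 1) ->
  exists s, [/\ 0 <= s <= 1, A (g s) &
    forall t, 0 <= t <= 1 -> A (g t) -> s <= t].
Proof.
move=> cg cA A1.
have [|s [hs slb sadh]] := inf_unit (P := fun t => A (g t)).
  by exists 1; rewrite ?lexx ?ler01.
exists s; split=> //; apply: contrapT => nAs.
have [e e0 he] := path_near cg hs (closed_openC cA) nAs.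
have [t [ht At te]] := sadh _ e0.
apply: (he t ht _ At); have := slb t ht At.
by rewrite ltr_norml; lra.
Qed.

(** * Segments of a uniquely arcwise connected space *)

(** The arc from [x] to [z].  The two endpoints are added by hand because
    [arc_between] never relates a point to itself, and [seg x x] should be the
    degenerate arc. *)
Definition seg x z : set T :=
  [set y | y = x \/ y = z \/ exists2 A, arc_between R x z A & A y].

Lemma seg_l x z : seg x z x. Proof. by left. Qed.
Lemma seg_r x z : seg x z z. Proof. by right; left. Qed.

Lemma seg_refl x : seg x x = [set x].
Proof.
apply/seteqP; split=> [y [->|[->|[A /arc_between_path]]]|y ->] //;
  last exact: seg_l.
move=> [g [[_ _ ig] g0 g1 _]].
have : 0 = 1 :> R by apply: ig; rewrite ?lexx ?ler01 ?g0 ?g1.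
lra.
Qed.

End arc_paths.

Section segments.
Context {R : realType} {T : metricType R}.
Hypothesis uac : uniquely_arcwise_connected R T.
Implicit Types (g h : R -> T) (a b c d s t : R) (x y z : T) (A : set T).

Lemma seg_image g a b : arc_path g a b -> seg (g a) (g b) = g @` `[a, b].
Proof.
move=> gab; have arc := arc_path_arc gab; case: gab => ab _ ig.
have gne : g a <> g b by move=> gE; suff: a = b by [lra]; apply: ig => //; lra.
have [A [_ Au]] := uac gne.
apply/seteqP; split=> y; last by move=> hy; right; right; exists (g @` `[a, b]).
case=> [->|[->|[A' arc' A'y]]].
- by exists a; rewrite //= in_itv /= lexx ltW.
- by exists b; rewrite //= in_itv /= lexx ltW.
- by rewrite -(Au _ arc) (Au _ arc').
Qed.

(** Degenerate segments are parametrized too, by a constant path; only the last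
    clause, injectivity, is lost for them. *)
Definition geodesic g x z : Prop :=
  [/\ g 0 = x, g 1 = z, {within `[0, 1], continuous g},
      forall c d, 0 <= c -> c <= d -> d <= 1 ->
        seg (g c) (g d) = g @` `[c, d] &
      x <> z -> arc_path g 0 1].

Lemma geodesic_exists x z : exists g, geodesic g x z.
Proof.
have [<-|/eqP xz] := eqVneq x z.
  exists (fun=> x); split=> //.
    by apply: continuous_subspaceT => ?; exact: cvg_cst.
  move=> c d _ cd _; rewrite seg_refl.
  apply/seteqP; split=> [y ->|y [t _ <-]] //.
  by exists c; rewrite //= in_itv /= ?lexx.
have [A [/arc_between_path[g [gp g0 g1 _]] _]] := uac xz.
have [_ cg _] := gp.
exists g; split=> // c d c0 cd d1.
move: cd; rewrite le_eqVlt => /orP[/eqP <-|cd].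
  rewrite seg_refl; apply/seteqP; split=> [y ->|y [t]].
    by exists c; rewrite //= in_itv /= ?lexx.
  rewrite /= in_itv /= => ht <-; suff -> : t = c by []. 
  lra.
by apply: seg_image; exact: arc_path_sub gp _ _ _.
Qed.

Lemma seg_subset_sym x z : seg x z `<=` seg z x.
Proof.
have [->//|/eqP zx] := eqVneq z x.
have [g [g0 g1 _ gs /(_ (nesym zx)) gp]] := geodesic_exists x z.
have := seg_image (arc_path_opp gp).
rewrite /= !opprK oppr0 g0 g1 => ->.
rewrite -g0 -g1 gs ?ler01// => y [t]; rewrite /= in_itv /= => ht <-.
by exists (- t); rewrite /= ?opprK// in_itv /=; lra.
Qed.

Lemma seg_sym x z : seg x z = seg z x.
Proof. by apply/seteqP; split; exact: seg_subset_sym. Qed.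

Lemma seg_closed x z : closed (seg x z).
Proof.
have [g [g0 g1 cg gs _]] := geodesic_exists x z.
rewrite -g0 -g1 gs ?ler01//.
apply: compact_closed; first exact: metric_hausdorff.
exact: continuous_compact cg (@segment_compact _ _ _).
Qed.

(** Follow the segment from [x] to [y] up to its first meeting with the segment
    from [y] to [z], then the latter to [z]: this is an arc, so it is the
    arc from [x] to [z]. *)
Lemma seg_triangle x y z : seg x z `<=` seg x y `|` seg y z.
Proof.
have [g [g0 g1 cg gs gp]] := geodesic_exists x y.
have [h [h0 h1 ch hs hp]] := geodesic_exists y z.
have [|s [s01 As smin]] := first_hit cg (@seg_closed y z).
  by rewrite g1; exact: seg_l.
have gS : seg x y = g @` `[0, 1] by rewrite -gs ?ler01 // g0 g1.
have hS : seg y z = h @` `[0, 1] by rewrite -hs ?ler01 // h0 h1.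
have [zs|zs] := pselect (z = g s).
  have -> : seg x z = g @` `[0, s] by rewrite zs -g0 gs //; lra.
  rewrite gS => w [t]; rewrite /= in_itv /= => ht <-; left; exists t => //.
  by rewrite /= in_itv /=; lra.
move: (As); rewrite hS => -[u]; rewrite /= in_itv /= => u01 hu.
have [s0|s0] := eqVneq s 0.
  have -> : seg x z = h @` `[u, 1] by rewrite -g0 -s0 -hu -h1 hs //; lra.
  move=> w [t]; rewrite /= in_itv /= => ht <-; right; exists t => //.
  by rewrite /= in_itv /=; lra.
have u1 : u != 1 by apply/eqP => u1; apply: zs; rewrite -hu u1.
have xy : x <> y.
  move=> xy; have : s <= 0.
    by apply: smin; rewrite ?lexx ?ler01// g0 xy; exact: seg_l.
  lra.
have yz : y <> z.
  by move=> yz; move: As; rewrite yz seg_refl => /esym.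
have gp' : arc_path g 0 s by apply: arc_path_sub (gp xy) _ _ _; lra.
have hp' : arc_path h u 1 by apply: arc_path_sub (hp yz) _ _ _; lra.
have [//|t v ht hv tv|k [kp k0 k1 kS]] := arc_path_cat gp' hp'.
- have ts : s <= t.
    by apply: smin; [lra | rewrite tv hS; exists v; rewrite //= in_itv /=; lra].
  have {}ts : t = s by lra.
  case: (hp yz) => _ _ ih; apply: ih; [lra|lra|].
  by rewrite -tv ts hu.
- have := seg_image kp; rewrite k0 k1 kS g0 h1 => ->.
  rewrite gS => w [] [t]; rewrite /= in_itv /= => ht <-; [left|right];
    by exists t; rewrite //= in_itv /=; lra.
Qed.

End segments.

Section betweenness.
Context {R : realType} {T : metricType R}.
Hypothesis uac : uniquely_arcwise_connected R T.
Implicit Types (g : R -> T) (s t : R) (x y z w q e : T).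

(** * The order seen from a root *)

Lemma geodesic_le g x z s t : geodesic g x z -> 0 <= s -> s <= t -> t <= 1 ->
  seg x (g t) (g s).
Proof.
move=> [<- _ _ gs _] s0 st t1; rewrite gs//; last by lra.
by exists s; rewrite //= in_itv /= s0.
Qed.

Lemma geodesic_below g x z t y : geodesic g x z -> 0 <= t -> t <= 1 ->
  seg x (g t) y -> exists s, [/\ 0 <= s, s <= t & y = g s].
Proof.
move=> [<- _ _ gs _] t0 t1; rewrite gs// => -[s]; rewrite /= in_itv /= => hs <-.
by exists s; split=> //; lra.
Qed.

Lemma geodesic_above g x z t y : geodesic g x z -> 0 <= t -> t <= 1 ->
  seg (g t) z y -> exists s, [/\ t <= s, s <= 1 & y = g s].
Proof.
move=> [_ <- _ gs _] t0 t1; rewrite gs// => -[s]; rewrite /= in_itv /= => hs <-.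
by exists s; split=> //; lra.
Qed.

Lemma geodesic_point g x z y : geodesic g x z -> seg x z y ->
  exists s, [/\ 0 <= s, s <= 1 & y = g s].
Proof.
move=> gxz; case: (gxz) => _ g1 _ _ _; rewrite -{1}g1.
exact: geodesic_below gxz ler01 (lexx 1).
Qed.

(** Read [seg x z y] as [y <= z] in the order rooted at [x]: the next three
    lemmas are transitivity, antisymmetry, and totality on lower sets. *)
Lemma seg_trans x y z w : seg x z y -> seg x y w -> seg x z w.
Proof.
have [g gxz] := geodesic_exists uac x z.
move=> /(geodesic_point gxz)[s [s0 s1 ->]].
move=> /(geodesic_below gxz s0 s1)[t [t0 ts ->]].
by case: (gxz) => _ g1 _ _ _; rewrite -{1}g1; apply: geodesic_le gxz _ _ _; lra.
Qed.

Lemma seg_anti x y z : seg x z y -> seg x y z -> y = z.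
Proof.
have [<-|/eqP xz] := eqVneq x z; first by rewrite seg_refl.
have [g gxz] := geodesic_exists uac x z.
move=> /(geodesic_point gxz)[s [s0 s1 ->]].
move=> /(geodesic_below gxz s0 s1)[t [t0 ts]].
case: (gxz) => _ z1 _ _ /(_ xz)[_ _ ig]; rewrite -z1 => /ig h.
by congr g; have : 1 = t by [apply: h; lra]; lra.
Qed.

Lemma seg_total x y z w : seg x z y -> seg x z w -> seg x y w \/ seg x w y.
Proof.
have [g gxz] := geodesic_exists uac x z.
move=> /(geodesic_point gxz)[s [s0 s1 ->]] /(geodesic_point gxz)[t [t0 t1 ->]].
by case: (lerP s t) => st; [right|left]; apply: geodesic_le gxz _ _ _; lra.
Qed.

(** With [seg_upper]: for [q <= e], the points between [q] and [e] in the order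
    rooted at [x] form the arc from [q] to [e], which no longer mentions the
    root. *)
Lemma seg_between x z q e : seg x e q -> seg q e z -> seg x z q.
Proof.
have [g gxe] := geodesic_exists uac x e.
move=> /(geodesic_point gxe)[s [s0 s1 ->]].
move=> /(geodesic_above gxe s0 s1)[t [st t1 ->]].
by apply: geodesic_le gxe _ _ _; lra.
Qed.

Lemma seg_upper x z q e : seg x z q -> seg x e z -> seg q e z.
Proof.
have [g gxe] := geodesic_exists uac x e.
move=> qz /(geodesic_point gxe)[t [t0 t1 ze]]; move: qz; rewrite ze.
move=> /(geodesic_below gxe t0 t1)[s [s0 st ->]].
case: (gxe) => _ g1 _ gs _; rewrite -{1}g1 gs//; last by lra.
by exists t; rewrite //= in_itv /=; lra.
Qed.

Lemma seg_near_left x z (U : set T) : x <> z -> open U -> U z ->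
  exists w, [/\ seg x z w, w <> z & forall y, seg w z y -> U y].
Proof.
move=> xz oU; have [g gxz] := geodesic_exists uac x z.
have [_ g1 cg _ /(_ xz)[_ _ ig]] := gxz; rewrite -{1}g1.
move=> /(path_near cg _ oU)[|e e0 he]; first by rewrite ler01 lexx.
have [s [s0 s1 se]] : exists s : R, [/\ 0 <= s, s < 1 & 1 - s < e].
  by case: (lerP e 1) => e1; [exists (1 - e / 2) | exists 0]; split; lra.
exists (g s); split.
- by rewrite -g1; apply: geodesic_le gxz _ _ _; lra.
- by rewrite -g1 => /ig h; suff : s = 1 by [lra]; apply: h; lra.
- move=> y /(geodesic_above gxz s0 (ltW s1))[t [st t1 ->]].
  by apply: he; rewrite ?ltr_norml; lra.
Qed.

Lemma seg_near_right x z (U : set T) : x <> z -> open U -> U x ->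
  exists w, [/\ seg x z w, w <> x & forall y, seg x w y -> U y].
Proof.
move=> /nesym xz oU Ux; have [w [zxw wx hw]] := seg_near_left xz oU Ux.
by exists w; split; rewrite 1?seg_sym// => y; rewrite seg_sym//; exact: hw.
Qed.

End betweenness.

(** * Branches and the finite cover *)

Lemma card_ge2 (X : Type) (B : set X) (a b : X) : B a -> B b -> a <> b ->
  `I_2 #<= B.
Proof.
move=> Ba Bb ab; pose h (i : nat) := if i == 0%N then a else b.
have : $|{injfun `I_2 >-> B}|.
  apply/injfunPex; exists h.
    by move=> i _; rewrite /h; case: ifP.
  move=> i j; rewrite !inE /= /h.
  by case: i j => [|[|i]] [|[|j]] //= _ _ E; case: ab.
by move=> -[u]; exact: inj_card_le u.
Qed.

Lemma not_ge2_card1 (X : Type) (B : set X) (a : X) : B a -> ~ (`I_2 #<= B) ->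
  B #= `I_1.
Proof.
move=> Ba nB; suff -> : B = [set a] by exact: card_set1.
apply/seteqP; split=> [b Bb|b ->//]; apply: contrapT => ba.
by apply: nB; exact: card_ge2 Bb Ba ba.
Qed.

(** The endpoints of the intervals whose union is [T] work for every root: an
    interval from [a] to [b] lies in the union of the arcs from the root to [a]
    and to [b], by [seg_triangle]. *)
Lemma tree_ends (R : realType) (T : metricType R) : tree T ->
  exists2 E : set T, finite_set E & forall x z, exists2 e, E e & seg x e z.
Proof.
move=> [uac [[p Tp]|[F [finF F0 Fint FT]]]].
  exists [set p] => // x z; exists p => //.
  by have : [set: T] z by []; rewrite Tp => ->; exact: seg_r.
have [z0] : exists z0 : T, True.
  by have [A FA] := F0; have [g _] := Fint A FA; exists (g 0).
move=> _; have /choice[p hp] :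
    forall A, exists p : T * T, F A -> arc_between R p.1 p.2 A.
  move=> A; have [FA|nFA] := pselect (F A); last by exists (z0, z0).
  by have [g [h gh]] := Fint A FA; exists (g 0, g 1) => _; exists g, h.
exists ((fun A => (p A).1) @` F `|` (fun A => (p A).2) @` F).
  by rewrite finite_setU; split; exact: finite_image.
move=> x z; have : [set: T] z by []; rewrite -FT => -[A FA Az].
have : seg (p A).1 (p A).2 z by right; right; exists A => //; exact: hp.
move=> /(@seg_triangle _ _ uac _ x _)[|] hz.
- by exists (p A).1; [left; exists A|rewrite seg_sym].
- by exists (p A).2 => //; right; exists A.
Qed.

(** * Topology of the rooted order *)

Section tree_topology.
Context {R : realType} {T : metricType R}.
Hypothesis uac : uniquely_arcwise_connected R T.
Variable E : set T.
Hypothesis finE : finite_set E.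
Hypothesis covE : forall x z, exists2 e, E e & seg x e z.
Implicit Types (g : R -> T) (s t : R) (x y z w q e m a b p : T).

(** A finite union of arcs: those from [q] to the ends above [q]. *)
Lemma above_closed x q : closed [set z | seg x z q].
Proof.
suff -> : [set z | seg x z q] =
    \bigcup_(e in E `&` [set e | seg x e q]) seg q e.
  apply: closed_bigcup => [|e _]; last exact: (@seg_closed _ _ uac).
  exact: finite_setIl.
apply/seteqP; split=> z /=.
  move=> qz; have [e Ee ez] := covE x z; exists e.
    by split=> //; exact: seg_trans ez qz.
  exact: (seg_upper uac qz ez).
by move=> [e [_ /= eq] ez]; exact: (seg_between uac eq ez).
Qed.

(** On the arc from [x] to an end [e], the points not strictly above [q] fill
    the arc from [x] to [q] if [q <= e] and the whole arc otherwise; so they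
    form a finite union of closed sets. *)
Lemma strictly_above_open x q : open [set z | seg x z q /\ z <> q].
Proof.
rewrite -closedC.
pose D e := seg x e `&` ~` [set z | seg x z q /\ z <> q].
have -> : ~` [set z | seg x z q /\ z <> q] = \bigcup_(e in E) D e.
  apply/seteqP; split=> z; last by move=> [e _ []].
  by move=> nz; have [e Ee ez] := covE x z; exists e.
apply: closed_bigcup => // e _.
have [eq|neq] := pselect (seg x e q).
  suff -> : D e = seg x q by exact: (@seg_closed _ _ uac).
  apply/seteqP; split=> z.
    move=> [ez /= nz]; have [qz|zq] := seg_total uac eq ez; first by [].
    have [->|/eqP zneq] := eqVneq z q; first exact: seg_r.
    by case: nz.
  move=> qz; split; first exact: (seg_trans uac eq qz).
  by move=> [zq]; apply; exact: (seg_anti uac qz zq).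
suff -> : D e = seg x e by exact: (@seg_closed _ _ uac).
apply/seteqP; split=> z; first by case.
move=> ez; split=> // -[zq _]; apply: neq; exact: (seg_trans uac ez zq).
Qed.

(** In the complement of [m], the points above [m] are both closed and open:
    they separate [z] from the root. *)
Lemma cut_point_between x m z : x <> m -> seg x z m -> z <> m -> cut_point m.
Proof.
move=> xm zm znm; pose C := connected_component (~` [set m]).
apply: (@card_ge2 _ _ (C x) (C z)); [by exists x|by exists z|move=> Cxz].
have Cz : C x z by rewrite Cxz; apply: connected_component_refl.
have Cx : C x x by apply: connected_component_refl.
have CC : connected (C x) by exact: component_connected.
have Cm y : C x y -> y <> m by move=> /connected_component_sub.
pose B := C x `&` [set y | seg x y m].
have BC : B = C x.
  apply: CC; first by exists z.
    exists [set y | seg x y m /\ y <> m]; first exact: strictly_above_open.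
    by apply/seteqP; split=> y [Cy /=]; [split=> //; split=> //; exact: Cm|case].
  by exists [set y | seg x y m]; first exact: above_closed.
have [_ /=] : B x by rewrite BC.
by rewrite seg_refl => /esym.
Qed.

Lemma noncut_maximal x m z : x <> m -> ~ cut_point m -> seg x z m -> z = m.
Proof.
move=> xm ncm zm; apply: contrapT => znm; apply: ncm.
exact: cut_point_between xm zm znm.
Qed.

(** As [m] is maximal, the arcs from the root to the ends other than [m] miss
    [m], and so does their union [K], which is closed.  Outside [K] there is
    only the arc from [x] to [m], on which continuity provides [q]. *)
Lemma noncut_nbhd x m (U : set T) : x <> m -> ~ cut_point m ->
  open U -> U m ->
  exists q, [/\ seg x m q, q <> m & forall z, seg x z q -> U z /\ seg x m z].
Proof.
move=> xm ncm oU Um.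
pose K := \bigcup_(e in E `&` [set e | ~ seg x e m]) seg x e.
have cK : closed K.
  apply: closed_bigcup => [|e _]; last exact: (@seg_closed _ _ uac).
  exact: finite_setIl.
have nKm : ~ K m by move=> [e [_ /= nem]].
have oUK : open (U `&` ~` K) by apply: openI => //; exact: closed_openC.
have [w [wm wnm hw]] := seg_near_left uac xm oUK (conj Um nKm).
exists w; split=> // z zw.
have [e Ee ez] := covE x z.
have ew := seg_trans uac ez zw.
have em : seg x e m.
  apply: contrapT => nem; have [_] := hw w (seg_l _ _); apply.
  by exists e.
have mz : seg x m z by rewrite -(noncut_maximal xm ncm em).
split=> //; have [] := hw z => //; exact: (seg_upper uac zw mz).
Qed.

(** * Points moved away from the root *)

Section self_map.
Variable f : T -> T.
Hypothesis contf : continuous f.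

Definition moves_up x y : Prop := seg x (f y) y /\ f y <> y.

Definition moves_up_below x z : Prop :=
  forall y, seg x z y -> y <> z -> moves_up x y.

Lemma moves_up_below_root x : moves_up_below x x.
Proof. by move=> y; rewrite seg_refl => ->. Qed.

(** The supremum along the arc satisfies the condition itself, because that
    condition on [z] involves only the points strictly below [z]. *)
Lemma moves_up_below_sup x e : exists c, [/\ seg x e c, moves_up_below x c &
  forall w, moves_up_below x w -> seg x e w -> seg x c w].
Proof.
have [<-|/eqP xe] := eqVneq x e.
  exists x; split; [exact: seg_l|exact: moves_up_below_root|by []].
have [g gxe] := geodesic_exists uac x e.
have [g0 g1 cg _ /(_ xe)[_ _ ig]] := gxe.
(* [inf_unit] is about infima, so the arc is run through from [e]. *)
have [|c [c01 clb cadh]] :=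
  inf_unit (P := fun t => moves_up_below x (g (1 - t))).
  exists 1; first by rewrite lexx ler01.
  rewrite subrr g0; exact: moves_up_below_root.
exists (g (1 - c)); split.
- by rewrite -g1; apply: geodesic_le gxe _ _ _; lra.
- move=> y /(geodesic_below gxe)[||s [s0 sc ->] nsc]; [lra|lra|].
  have sltc : s < 1 - c.
    by rewrite lt_neqAle sc andbT; apply/eqP => sE; apply: nsc; rewrite sE.
  have [t [t01 Wt tc]] := cadh (1 - c - s) ltac:(lra).
  apply: Wt.
    by apply: geodesic_le gxe _ _ _; lra.
  by move=> /ig h; suff : s = 1 - t by [lra]; apply: h; lra.
- move=> w Ww /(geodesic_point gxe)[s [s0 s1 wE]]; rewrite wE.
  have := clb (1 - s); rewrite subKr -wE => /(_ ltac:(lra) Ww) cs.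
  by rewrite wE; apply: geodesic_le gxe _ _ _; lra.
Qed.

(** Over a list of ends: keep the candidate [m] unless some [w >= m] below the
    next end [e] satisfies the condition, and then replace [m] by the supremum
    for [e], which is above [w]. *)
Lemma moves_up_below_max x : exists2 m, moves_up_below x m &
  forall w, moves_up_below x w -> seg x w m -> w = m.
Proof.
have /finite_seqP[l lE] := finE.
suff [m Wm mmax] : exists2 m, moves_up_below x m & forall w e, e \in l ->
    moves_up_below x w -> seg x w m -> seg x e w -> w = m.
  exists m => // w Ww wm; have [e Ee ew] := covE x w.
  by apply: (mmax w e) => //; move: Ee; rewrite lE.
elim: l {lE} => [|e l [m Wm mmax]].
  by exists x; [exact: moves_up_below_root|].
have [[w [Ww wm ew]]|nw] := pselect (exists w,
    [/\ moves_up_below x w, seg x w m & seg x e w]); last first.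
  exists m => // w e'; rewrite inE => /predU1P[->|]; last exact: mmax.
  by move=> Ww wm ew; case: nw; exists w.
have [c [ec Wc cmax]] := moves_up_below_sup x e.
have cm : seg x c m by exact: (seg_trans uac (cmax _ Ww ew) wm).
exists c => // v e'; rewrite inE => /predU1P[->|e'l] Wv vc ev.
  exact: (seg_anti uac (cmax _ Wv ev) vc).
have vE := mmax v e' e'l Wv (seg_trans uac vc cm) ev.
by apply: (seg_anti uac _ vc); rewrite vE.
Qed.

(** If not [m <= f m], some [w < m] satisfies not [w <= f m], since the arc from
    [x] to [f m] is closed.  For [v < m] close to [m] then [w < v <= f v], while
    [f v] is close to [f m]: this contradicts that the points above [w] form a
    closed set. *)
Lemma moves_up_below_le x m : moves_up_below x m -> seg x (f m) m.
Proof.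
move=> Wm; have [->|/eqP/nesym xm] := eqVneq m x; first exact: seg_l.
apply: contrapT => nm.
have [w [wm wnm hw]] :=
  seg_near_left uac xm (closed_openC (@seg_closed _ _ uac x (f m))) nm.
have nw : ~ seg x (f m) w by apply: (hw w); exact: seg_l.
pose U := f @^-1` (~` [set z | seg x z w]) `&` [set z | seg x z w /\ z <> w].
have oU : open U.
  apply: openI; last exact: strictly_above_open.
  apply: open_comp => [z _|]; first exact: contf.
    exact/closed_openC/above_closed.
have [|v [vm vnm hv]] := seg_near_left uac xm oU.
  by split=> //=; split=> //; exact: nesym.
have [/= + [vw _]] := hv v (seg_l _ _); apply.
have [fv _] := Wm v vm vnm.
exact: (seg_trans uac fv vw).
Qed.

(** If [m < f m], choose [q] strictly between.  The points [y] of the arc from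
    [m] to [q] close enough to [m] satisfy [y <= q < f y], so a point slightly
    above [m] would satisfy the condition too. *)
Lemma moves_up_below_max_fixed x m : moves_up_below x m ->
  (forall w, moves_up_below x w -> seg x w m -> w = m) -> f m = m.
Proof.
move=> Wm mmax; have mf := moves_up_below_le Wm.
apply: contrapT => fm.
have oC : open (~` [set f m]).
  apply: closed_openC; rewrite -(seg_refl (f m)).
  exact: (@seg_closed _ _ uac).
have [q [fq qm hq]] := seg_near_right uac (nesym fm) oC (nesym fm).
have qf : q <> f m by apply: (hq q); exact: seg_r.
have xqm : seg x q m by exact: (seg_between uac mf fq).
have xfq : seg x (f m) q.
  rewrite seg_sym//.
  by apply: (seg_trans uac (_ : seg _ _ m) _); rewrite seg_sym.
pose U := f @^-1` [set z | seg x z q /\ z <> q].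
have oU : open U.
  by apply: open_comp => [z _|]; [exact: contf|exact: strictly_above_open].
have Um : U m by split=> //; exact: nesym.
have [w [qw wm hw]] := seg_near_right uac (nesym qm) oU Um.
have xwm : seg x w m by exact: (seg_between uac xqm qw).
have xqw : seg x q w.
  rewrite seg_sym//.
  by apply: (seg_trans uac (_ : seg _ _ m) _); rewrite seg_sym.
apply: wm; apply: mmax => // y wy _.
have upm : moves_up x m by [].
have [ym|my] := seg_total uac xwm wy.
  by have [->//|/eqP ynm] := eqVneq y m; exact: Wm.
have [fyq fynq] : U y by apply: hw; exact: (seg_upper uac my wy).
have qy := seg_trans uac xqw wy.
split; first exact: (seg_trans uac fyq qy).
by move=> fy; apply: fynq; apply: (seg_anti uac _ fyq); rewrite fy.
Qed.

(** A basic neighbourhood [{z | q < z}] of [m] lies on the arc from [x] to [m],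
    and there [q <= z < m] gives [q <= z < f z]. *)
Lemma moves_up_below_attracting x m : x <> m -> ~ cut_point m ->
  f m = m -> moves_up_below x m -> attracting_fixed_point f m.
Proof.
move=> xm ncm fm Wm U oU Um.
have [q [mq qnm hq]] := noncut_nbhd xm ncm oU Um.
exists [set z | seg x z q /\ z <> q]; split.
- exact: strictly_above_open.
- by split=> //; exact: nesym.
- by move=> z [/hq[]].
move=> _ [z zV <-].
have zq : seg x z q.
  suff : [set z | seg x z q] z by [].
  have /closure_id -> := @above_closed x q; apply: closureS zV.
  by move=> ? [].
have [->|/eqP znm] := eqVneq z m; first by rewrite fm; split=> //; exact: nesym.
have [fz fzn] := Wm z (hq z zq).2 znm.
split; first exact: (seg_trans uac fz zq).
by move=> fzq; apply: fzn; apply: (seg_anti uac _ fz); rewrite fzq.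
Qed.

(** Take an attracting neighbourhood [V] of [m] within the arc from [x] to [m].
    Its lowest boundary point [y] on that arc is in the closure of [V] but not
    in [V], and [f y] is in [V]; hence [y < f y]. *)
Lemma attracting_moves_up x m p : x <> m -> ~ cut_point m ->
  attracting_fixed_point f m -> seg x m p -> p <> m ->
  exists y, [/\ seg x y p, seg x m y, y <> m, seg x m (f y) & moves_up x y].
Proof.
move=> xm ncm fm mp pnm.
have npm : ~ seg x p m by move=> pm; apply: pnm; exact: (seg_anti uac mp pm).
have [q [mq qnm hq]] :=
  noncut_nbhd xm ncm (closed_openC (@seg_closed _ _ uac x p)) npm.
have [|V [oV Vm VU fV]] := fm _ (@strictly_above_open x q).
  by split=> //; exact: nesym.
have [g gxm] := geodesic_exists uac x m.
have [g0 g1 cg _ _] := gxm.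
have [|c [c01 clb cadh]] := inf_unit (P := fun t => V (g t)).
  by exists 1; rewrite ?g1 // lexx ler01.
have cV : closure V (g c).
  move=> B; rewrite nbhsE => -[B' [oB' B'c] B'B].
  have [e e0 he] := path_near cg c01 oB' B'c.
  have [t [t01 Vt te]] := cadh _ e0; exists (g t); split=> //.
  apply/B'B/he => //; have := clb t t01 Vt; rewrite ltr_norml; lra.
have nV : ~ V (g c).
  move=> Vc; have [e e0 he] := path_near cg c01 oV Vc.
  (* [V] misses the root, so there is room below [g c]. *)
  have c0 : c != 0.
    apply/eqP => c0; have [] := VU _ Vc.
    by rewrite c0 g0 seg_refl => ->.
  have [t [t01 tc te]] : exists t : R, [/\ 0 <= t <= 1, t < c & c - t < e].
    by case: (lerP e c) => ec; [exists (c - e / 2)|exists 0]; split; lra.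
  have := clb t t01 (he t t01 _); rewrite ltr_norml; lra.
have Vf : V (f (g c)) by apply: fV; exists (g c).
have [fq _] := VU _ Vf.
have [_ mf] := hq _ fq.
have mc : seg x m (g c) by rewrite -g1; apply: geodesic_le gxm _ _ _; lra.
exists (g c); split=> //.
- have qc : seg x (g c) q.
    suff : [set z | seg x z q] (g c) by [].
    have /closure_id -> := @above_closed x q; apply: closureS cV.
    by move=> ? /VU[].
  by have [] := seg_total uac mp mc => // /(hq _ qc).1.
- by move=> cm; apply: nV; rewrite cm.
split; last by move=> fc; apply: nV; rewrite -fc.
move: Vf; have [t [t0 t1 ->]] := geodesic_point gxm mf => Vt.
by apply: geodesic_le gxm _ _ _ => //; [lra | apply: clb => //; lra].
Qed.

(** * Maps without fixed cut-points *)

Hypothesis nofix : forall x : T, cut_point x -> f x <> x.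

Lemma attracting_noncut m : attracting_fixed_point f m -> ~ cut_point m.
Proof. by move=> /attracting_fixed_point_fixed fm /nofix. Qed.

Lemma midpoint a b : a <> b -> exists p, [/\ p <> a, p <> b & seg a b p].
Proof.
move=> ab; have [g gab] := geodesic_exists uac a b.
have [g0 g1 _ _ /(_ ab)[_ _ ig]] := gab.
exists (g (1 / 2)); split.
- by rewrite -g0 => /ig h; suff : 1 / 2 = 0 :> R by [lra]; apply: h; lra.
- by rewrite -g1 => /ig h; suff : 1 / 2 = 1 :> R by [lra]; apply: h; lra.
- by rewrite -g1; apply: geodesic_le gab _ _ _; lra.
Qed.

(** On the arc from [a] to [b], a point [y2] moves towards [a] and a later point
    [y1] moves towards [b].  In the order rooted at [a], the infimum of the
    points after [y2] that lie below their image would be a fixed cut-point, or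
    not an infimum. *)
Lemma attracting_unique a b : attracting_fixed_point f a ->
  attracting_fixed_point f b -> a = b.
Proof.
move=> fa fb; apply: contrapT => ab.
have [p [pa pb abp]] := midpoint ab.
have [y1 [y1p by1 y1b _ [fy1 _]]] :=
  attracting_moves_up ab (attracting_noncut fb) fb abp pb.
have bap : seg b a p by rewrite seg_sym.
have [y2 [y2p ay2 y2a afy2 [fy2 nfy2]]] :=
  attracting_moves_up (nesym ab) (attracting_noncut fa) fa bap pa.
have nup2 : ~ seg a (f y2) y2.
  move=> up; apply: nfy2; apply: (seg_anti uac _ up).
  apply: (seg_between uac (_ : seg a b _) _); first by rewrite seg_sym.
  by rewrite seg_sym.
have py2 : seg a p y2 by rewrite seg_sym//; exact: (seg_upper uac y2p ay2).
have y12 := seg_trans uac y1p py2.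
have [g gab] := geodesic_exists uac a b.
have [g0 g1 cg _ /(_ ab)[_ _ ig]] := gab.
have [s1 [s10 s11 y1E]] := geodesic_point gab by1.
move: y12; rewrite y1E => /(geodesic_below gab s10 s11)[s2 [s20 s21 y2E]].
pose P t := s2 <= t /\ seg a (f (g t)) (g t).
have [|c [c01 clb cadh]] := inf_unit (P := P).
  by exists s1; [lra | split=> //; rewrite -y1E].
have cs1 : c <= s1 by apply: clb; [lra | split=> //; rewrite -y1E].
have s2c : s2 <= c.
  rewrite leNgt; apply/negP => cs2; have e0 : 0 < s2 - c by lra.
  have [t [_ [s2t _]]] := cadh _ e0.
  by rewrite subrKC ltNge s2t.
have Pc : seg a (f (g c)) (g c).
  apply: contrapT => nc.
  have oU : open (f @^-1` (~` [set z | seg a z (g c)])).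
    apply: open_comp => [z _|]; first exact: contf.
    exact/closed_openC/above_closed.
  have [e e0 he] := path_near cg c01 oU nc.
  have [t [t01 Pt te]] := cadh _ e0; have ct := clb t t01 Pt.
  apply: (he t t01); first by rewrite ltr_norml; lra.
  apply: (seg_trans uac Pt.2 _); apply: geodesic_le gab _ _ _; lra.
have {}s2c : s2 < c.
  rewrite lt_neqAle s2c andbT; apply/eqP => s2E.
  by apply: nup2; rewrite y2E s2E.
have s1lt : s1 != 1 by apply/eqP => s1E; apply: y1b; rewrite y1E s1E.
have cutc : cut_point (g c).
  apply: (@cut_point_between a _ b).
  - by rewrite -g0 => /ig h; suff : 0 = c by [lra]; apply: h; lra.
  - by rewrite -g1; apply: geodesic_le gab _ _ _; lra.
  - by rewrite -g1 => /ig h; suff : 1 = c by [lra]; apply: h; lra.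
have oU : open (f @^-1` [set z | seg a z (g c) /\ z <> g c]).
  by apply: open_comp => [z _|]; [exact: contf|exact: strictly_above_open].
have [e e0 he] := path_near cg c01 oU (conj Pc (nofix cutc)).
have [t [s2t tc te]] : exists t : R, [/\ s2 <= t, t < c & c - t < e].
  by case: (lerP e (c - s2)) => ec; [exists (c - e / 2)|exists s2]; split; lra.
have [|fgt _] := he t _ ltac:(rewrite ltr_norml; lra); first by lra.
suff : c <= t by lra.
apply: clb; first lra.
split=> //; apply: (seg_trans uac fgt _); apply: geodesic_le gab _ _ _; lra.
Qed.

Lemma attracting_exists a b : a <> b -> exists m, attracting_fixed_point f m.
Proof.
move=> ab; have [x [xa xb abx]] := midpoint ab.
have fx : f x <> x.
  by apply: nofix; exact: cut_point_between (nesym xa) abx (nesym xb).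
have [m Wm mmax] := moves_up_below_max x.
have fm := moves_up_below_max_fixed Wm mmax.
exists m; apply: (@moves_up_below_attracting x) => //.
  by move=> xm; apply: fx; rewrite xm.
by move=> /nofix.
Qed.

End self_map.
End tree_topology.

Theorem lemma4 (R : realType) (T : metricType R) (f : T -> T)
    (treeT : tree T) (contf : continuous f)
    (nofix : forall x : T, cut_point x -> f x <> x) :
  (exists! x : T, attracting_fixed_point f x) /\
  (forall x : T, attracting_fixed_point f x -> ~ one_point T -> endpoint x).
Proof.
have [E finE covE] := tree_ends treeT.
have [uac _] := treeT.
split.
  have [[a Ta]|n1] := pselect (one_point T).
    have eqa y : y = a by have : [set: T] y by []; rewrite Ta.
    exists a; split=> [U oU Ua|y _]; last by rewrite (eqa y).
    exists U; split=> // _ [y _ <-]; by rewrite (eqa (f y)).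
  have [a _] : exists a : T, True.
    case: treeT => _ [[a _]|[F [_ [A FA] Fint _]]]; first by exists a.
    by have [g _] := Fint A FA; exists (g 0).
  have [b ab] : exists b, a <> b.
    apply: contrapT => nb; apply: n1; exists a; apply/seteqP; split=> // b _.
    by apply: contrapT => ba; apply: nb; exists b; exact: nesym.
  have [m fm] := attracting_exists uac finE covE contf nofix ab.
  by exists m; split=> // m' fm';
    exact: (attracting_unique uac finE covE contf nofix).
move=> x fx n1.
have [z zx] : exists z, z <> x.
  apply: contrapT => nz; apply: n1; exists x; apply/seteqP; split=> // z _.
  by apply: contrapT => zx; apply: nz; exists z.
apply: (@not_ge2_card1 _ _ (connected_component (~` [set x]) z)).
  by exists z.
exact: attracting_noncut nofix _ fx.
Qed.
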